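(* Let $n\in\mathbb{N}$, let $\mathcal{U}\subset\mathbb{R}^n$ be a non-empty, compact and convex set, and let $\mathcal{X}\subset\mathbb{R}^n$ be a compact and convex set containing $\mathcal{U}$. Let $\|\cdot\|$ be the Euclidean norm on $\mathbb{R}^n$. Define, for $U=(u_1,\ldots,u_{n+1})\in\mathcal{U}^{n+1}$, $$ \mathcal{G}(U) := \inf_{(t,x)\in\mathbb{R}\times\mathcal{X}}\bigl\{\, t \;\big|\; \|u_i-x\|^2\le t \ \text{ for } i=1,\ldots,n+1 \,\bigr\}. $$ Then $\mathcal{G}$ is a real-valued function on $\mathcal{U}^{n+1}$, it is Lipschitz continuous on $\mathcal{U}^{n+1}$, and $$ \inf_{x\in\mathcal{X}}\ \sup_{u\in\mathcal{U}}\ \|u-x\|^2 \;=\; \sup_{U\in\mathcal{U}^{n+1}}\mathcal{G}(U). $$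
   Context: The quantity $\inf_{x\in\mathcal{X}}\sup_{u\in\mathcal{U}}\|u-x\|^2$ is the value of the smooth (squared) Chebyshev center problem. It equals the value of the convex semi-infinite program $\inf_{(t,x)\in\mathbb{R}\times\mathcal{X}}\{t \mid \|u-x\|^2-t\le 0 \text{ for all } u\in\mathcal{U}\}$. Lipschitz continuity of $\mathcal{G}$ is with respect to a norm on $(\mathbb{R}^n)^{n+1}$ (all such norms are equivalent). *)

(* Defs.v *)
From HB Require Import structures.
From mathcomp Require Import all_boot all_order all_algebra.
From mathcomp Require Import all_classical all_reals all_analysis.

Set Implicit Arguments.
Unset Strict Implicit.
Unset Printing Implicit Defensive.

Import Order.TTheory GRing.Theory Num.Theory.
Import numFieldNormedType.Exports.

Local Open Scope classical_set_scope.
Local Open Scope ring_scope.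

(* The canonical norm `|x| of 'rV[R]_n is the max norm, hence this separate
   definition; both induce the topology used by compact. *)
Definition enorm (R : realType) (n : nat) (x : 'rV[R]_n) : R :=
  Num.sqrt (\sum_(i < n) x 0 i ^+ 2).

(* An m-tuple (u_1, ..., u_m) of points of R^n is the matrix whose rows
   are the u_i; the set below is the power A^m of a set A of R^n. *)
Definition row_power (R : realType) (m n : nat) (A : set 'rV[R]_n) :
    set 'M[R]_(m, n) :=
  [set M | forall i : 'I_m, A (row i M)].

(* The infimum is taken in \bar R, so that its finiteness is a genuine claim
   rather than a default value of a real-valued infimum. *)
Definition cheb_value (R : realType) (m n : nat) (X : set 'rV[R]_n)
    (M : 'M[R]_(m, n)) : \bar R :=
  ereal_inf [set tx.1%:E | tx in [set tx : R * 'rV[R]_n |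
    X tx.2 /\ forall i : 'I_m, enorm (row i M - tx.2) ^+ 2 <= tx.1]].

(* Main.v *)
(* If t exceeds every G(M), then any n+1 of the sets
   X `&` {x | |u - x|^2 <= t}, u in U, meet. These sets are compact and convex,
   so by Helly's theorem they have a common point, whose squared distance to U
   is at most t; letting t decrease to sup G gives the nontrivial inequality.
   For the Lipschitz bound, moving each u_i by at most d in max norm changes
   |u_i - x|^2 by at most 4 n C d when X lies in the max-norm ball of radius C,
   uniformly in x, hence changes the infimum by at most as much. *)
Require Import Defs.
From HB Require Import structures.
From mathcomp Require Import all_boot all_order all_algebra ring lra.
From mathcomp Require Import all_classical all_reals all_analysis.
Set Implicit Arguments.
Unset Strict Implicit.
Unset Printing Implicit Defensive.
Import Order.TTheory GRing.Theory Num.Theory.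
Import numFieldNormedType.Exports.
Local Open Scope classical_set_scope.
Local Open Scope ring_scope.

(** * Convexity and Helly's theorem *)

Lemma convex_setP (R : numDomainType) (M : lmodType R)
    (A : set (convex_lmodType M)) :
  convex_set A <->
  forall (x y : M) (t : R), 0 <= t <= 1 -> A x -> A y ->
    A (t *: x + (1 - t) *: y).
Proof.
split=> cA x y t => [/andP[t0 t1] Ax Ay|].
  by have := cA x y (Itv01 t0 t1); rewrite !inE; apply.
by rewrite !inE; apply: cA; rewrite ge0 le1.
Qed.

(** The pairs (W y, W) with W >= 0 and y in [A] are closed under addition: they form the cone over
    [A]. A point of [A] is still needed when the total weight is 0. *)
Lemma convex_sum (R : numFieldType) (M : lmodType R)
    (A : set (convex_lmodType M)) (I : Type) (s : seq I) (P : pred I)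
    (w : I -> R) (x : I -> M) :
  convex_set A -> A !=set0 ->
  (forall i, P i -> 0 <= w i) -> (forall i, P i -> A (x i)) ->
  exists2 y : M, A y &
    \sum_(i <- s | P i) w i *: x i = (\sum_(i <- s | P i) w i) *: y.
Proof.
move=> cA [a Aa] w0 xA.
(* Keeping the total weight separate avoids dividing by a zero partial sum. *)
pose K (v : M) (W : R) := 0 <= W /\ exists2 y : M, A y & v = W *: y.
suff [] : K (\sum_(i <- s | P i) w i *: x i) (\sum_(i <- s | P i) w i) by [].
apply: (big_ind2 K).
- by split=> //; exists a => //; rewrite scale0r.
- move=> _ V _ W [V0 [y Ay ->]] [W0 [z Az ->]]; split; first exact: addr_ge0.
  have [VW0|VW0] := eqVneq (V + W) 0.
    have [V_0 W_0] : V = 0 /\ W = 0.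
      by move: VW0 => /eqP; rewrite paddr_eq0// => /andP[/eqP-> /eqP->].
    by exists a => //; rewrite V_0 W_0 addr0 !scale0r addr0.
  have VWgt0 : 0 < V + W by rewrite lt_def VW0 addr_ge0.
  exists ((V / (V + W)) *: y + (1 - V / (V + W)) *: z).
    apply: (convex_setP A).1 => //; rewrite divr_ge0 ?(ltW VWgt0)//=.
    by rewrite ler_pdivrMr// mul1r lerDl.
  rewrite scalerDr !scalerA mulrBr mulr1 mulrCA divff// mulr1.
  by rewrite addrAC subrr add0r.
- by move=> i Pi; split; [exact: w0|exists (x i) => //; exact: xA].
Qed.

(** More than n+1 vectors (1, p_j) in dimension n+1 are linearly dependent; the leading 1 makes the
    coefficients sum to 0. *)
Lemma affine_dependence (F : fieldType) (m n : nat) (p : 'I_m -> 'rV[F]_n) :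
  (n.+1 < m)%N ->
  exists2 l : 'rV[F]_m, l != 0 &
    \sum_j l 0 j = 0 /\ \sum_j l 0 j *: p j = 0.
Proof.
move=> nm; pose A := row_mx (const_mx 1 : 'M[F]_(m, 1)) (\matrix_j p j).
have /rowV0Pn[l /sub_kermxP lA l0] : kermx A != 0.
  rewrite -mxrank_eq0 mxrank_ker -lt0n subn_gt0.
  exact: leq_ltn_trans (rank_leq_col A) nm.
exists l => //; move: lA; rewrite mul_mx_row -row_mx0 => /eq_row_mx[l1 lp].
split.
  have /matrixP/(_ 0 0) := l1; rewrite !mxE => l1E.
  by rewrite -[RHS]l1E; apply: eq_bigr => j _; rewrite mxE mulr1.
by rewrite -[RHS]lp mulmx_sum_row; apply: eq_bigr => j _; rewrite rowK.
Qed.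

(* Radon's argument: splitting an affine dependence of points [p j], each lying
   in all the sets but the [j]-th, by the sign of its coefficients gives a point
   that is at once in the convex hull of either part. *)
Lemma helly (R : realFieldType) (n : nat) (T : Type)
    (C : T -> set (convex_lmodType 'rV[R]_n)) :
  (forall i, convex_set (C i)) ->
  (forall f : 'I_n.+1 -> T, \bigcap_k C (f k) !=set0) ->
  forall m (g : 'I_m -> T), \bigcap_k C (g k) !=set0.
Proof.
move=> cC Cf; elim=> [|m IHm] g; first by exists 0 => -[].
have [mn|nm] := leqP m.+1 n.+1.
  (* [inord] pads a family of at most n+1 sets to exactly n+1 by repetition. *)
  have [x Cx] := Cf (fun k => g (inord k)).
  exists x => k _; have := Cx (widen_ord mn k) I.
  by rewrite /= inord_val.
have /choice[p Cp] : forall j : 'I_m.+1, exists x : 'rV[R]_n,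
    forall i, i != j -> C (g i) x.
  move=> j; have [x Cx] := IHm (g \o lift j); exists x => i.
  by rewrite eq_sym => /unlift_some[k -> _]; exact: Cx.
have [l l_neq0 [l_sum l_comb]] := affine_dependence p nm.
pose s := \sum_(j | 0 < l 0 j) l 0 j.
have sN : \sum_(j | ~~ (0 < l 0 j)) - l 0 j = s.
  rewrite sumrN; apply/esym/eqP; rewrite -addr_eq0; apply/eqP.
  by rewrite -[RHS]l_sum [RHS](bigID (fun j => 0 < l 0 j)).
have combN : \sum_(j | ~~ (0 < l 0 j)) - l 0 j *: p j =
    \sum_(j | 0 < l 0 j) l 0 j *: p j.
  under eq_bigr do rewrite scaleNr.
  rewrite sumrN; apply/esym/eqP; rewrite -addr_eq0; apply/eqP.
  by rewrite -[RHS]l_comb [RHS](bigID (fun j => 0 < l 0 j)).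
have lN j : ~~ (0 < l 0 j) -> 0 <= - l 0 j by rewrite -leNgt oppr_ge0.
(* If the positive coefficients summed to 0, so would the others by [sN], and [l] would vanish. *)
have s_neq0 : s != 0.
  apply: contra l_neq0 => /eqP s0; apply/eqP/rowP => j; rewrite mxE.
  have [lj|lj] := boolP (0 < l 0 j).
    by have /psumr_eq0P := s0; apply=> // i /ltW.
  apply/eqP; rewrite -oppr_eq0; apply/eqP; rewrite s0 in sN.
  exact: (psumr_eq0P lN sN).
have C0 i : C i !=set0.
  by have [x Cx] := Cf (fun=> i); exists x; exact: (Cx 0 I).
exists (s^-1 *: \sum_(j | 0 < l 0 j) l 0 j *: p j) => i _ /=.
(* The i-th set contains every [p j] of the part to which i does not belong, so the representation
   over that part is used. *)
have [li|li] := boolP (0 < l 0 i).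
  rewrite -combN.
  have [||y Cy ->] := @convex_sum _ _ (C (g i)) _ (index_enum 'I_m.+1)
      (fun j => ~~ (0 < l 0 j)) (fun j => - l 0 j) p (cC _) (C0 _).
  - exact: lN.
  - by move=> j lj; apply: Cp; apply: contraNneq lj => <-.
  - by rewrite sN scalerA mulVf// scale1r.
have [||y Cy ->] := @convex_sum _ _ (C (g i)) _ (index_enum 'I_m.+1)
    (fun j => 0 < l 0 j) (fun j => l 0 j) p (cC _) (C0 _).
- by move=> j /ltW.
- by move=> j lj; apply: Cp; apply: contraNneq li => ->.
- by rewrite scalerA mulVf// scale1r.
Qed.

(** Helly on finite subfamilies yields the finite intersection property, and compactness of [X] does
    the rest. *)
Lemma helly_compact (R : realType) (n : nat) (I : choiceType)
    (X : set 'rV[R]_n) (C : I -> set 'rV[R]_n) :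
  compact X -> (forall i, closed (C i)) ->
  (forall i, @convex_set R 'rV[R]_n (X `&` C i)) ->
  (forall f : 'I_n.+1 -> I, \bigcap_k (X `&` C (f k)) !=set0) ->
  \bigcap_i (X `&` C i) !=set0.
Proof.
rewrite compact_In0 => cX clC cvC Cf.
apply: (cX _ setT (fun i => X `&` C i)); first by exists C.
move=> D _.
have [x Cx] := helly cvC Cf (tnth (in_tuple (finmap.enum_fset D))).
exists x => i /= iD.
have /tnthP[k ->] : i \in in_tuple (finmap.enum_fset D) by [].
exact: Cx.
Qed.

(** * Squared Euclidean distance *)

Lemma sqr_enorm (R : realType) (n : nat) (x : 'rV[R]_n) :
  enorm x ^+ 2 = \sum_(i < n) x 0 i ^+ 2.
Proof. by rewrite sqr_sqrtr// sumr_ge0// => i _; rewrite sqr_ge0. Qed.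

Lemma closed_eball (R : realType) (n : nat) (u : 'rV[R]_n) (t : R) :
  closed [set x : 'rV[R]_n | enorm (u - x) ^+ 2 <= t].
Proof.
under eq_set do rewrite sqr_enorm.
apply: (@closed_comp _ _ (fun x : 'rV[R]_n => \sum_(i < n) (u - x) 0 i ^+ 2)
  [set y | y <= t]); last exact: closed_le.
move=> x _; apply: (@cvg_big _ _ _ _ _ _ _ (nbhs x)) => [|i _].
  exact: add_continuous.
under eq_cvg do rewrite !mxE.
rewrite !mxE.
apply: cvgM; apply: cvgB; try exact: cvg_cst; exact: coord_continuous.
Qed.

Lemma convex_eball (R : realType) (n : nat) (u : 'rV[R]_n) (r : R) :
  @convex_set R 'rV[R]_n [set x | enorm (u - x) ^+ 2 <= r].
Proof.
apply/convex_setP => x y t /andP[t0 t1] /=; rewrite !sqr_enorm => xr yr.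
have -> : r = t * r + (1 - t) * r by ring.
apply: (@le_trans _ _ (t * (\sum_i (u - x) 0 i ^+ 2) +
    (1 - t) * (\sum_i (u - y) 0 i ^+ 2))).
  rewrite !mulr_sumr -big_split/=; apply: ler_sum => i _; rewrite !mxE.
  (* This is exactly the gap in the convexity inequality for the square, coordinate by
     coordinate. *)
  have : 0 <= t * (1 - t) * (x 0 i - y 0 i) ^+ 2.
    by rewrite mulr_ge0 ?sqr_ge0// mulr_ge0// subr_ge0.
  by lra.
by apply: lerD; apply: ler_wpM2l; rewrite ?subr_ge0.
Qed.

Lemma ler_entry_norm (R : realType) (m n : nat) (M : 'M[R]_(m, n)) i j :
  `|M i j| <= `|M|.
Proof.
rewrite [leRHS]/Num.norm/= mx_normrE.
by apply/bigmax_geP; right; exists (i, j).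
Qed.

(** * Finiteness and perturbation of [cheb_value] *)

(** A row bounds every feasible t below by a square; with no rows t would be unconstrained, hence
    [m.+1]. *)
Lemma cheb_value_ge0 (R : realType) (m n : nat) (X : set 'rV[R]_n)
    (M : 'M[R]_(m.+1, n)) : (0 <= cheb_value X M)%E.
Proof.
apply: le_ereal_inf_tmp => _ [[t x] [_ /= tx] <-].
by rewrite lee_fin (le_trans _ (tx ord0))// sqr_ge0.
Qed.

Lemma cheb_value_fin_num (R : realType) (m n : nat) (X : set 'rV[R]_n)
    (M : 'M[R]_(m.+1, n)) : X !=set0 -> cheb_value X M \is a fin_num.
Proof.
move=> [x Xx]; rewrite ge0_fin_numE ?cheb_value_ge0//.
(* The sum dominates each of its terms, so it is feasible together with [x]. *)
pose t := \sum_i enorm (row i M - x) ^+ 2.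
apply: (@le_lt_trans _ _ t%:E); last exact: ltry.
apply: ereal_inf_lbound; exists (t, x) => //; split=> // i.
by rewrite /= /t (bigD1 i)//= lerDl sumr_ge0// => k _; rewrite sqr_ge0.
Qed.

Lemma cheb_value_le (R : realType) (m n : nat) (X : set 'rV[R]_n)
    (M N : 'M[R]_(m, n)) (d : R) :
  (forall x, X x -> forall i,
    enorm (row i M - x) ^+ 2 <= enorm (row i N - x) ^+ 2 + d) ->
  (cheb_value X M <= cheb_value X N + d%:E)%E.
Proof.
move=> MN; rewrite -leeBlDr//.
apply: le_ereal_inf_tmp => _ [[t x] [/= Xx tx] <-].
rewrite EFinN leeBlDr// -EFinD; apply: ereal_inf_lbound.
exists (t + d, x) => //; split=> //= i.
by rewrite (le_trans (MN x Xx i))// lerD2r.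
Qed.

Lemma sqr_enorm_sub_le (R : realType) (n : nat) (u v x : 'rV[R]_n)
    (B d : R) :
  0 <= B -> (forall i, `|u 0 i| <= B) -> (forall i, `|v 0 i| <= B) ->
  (forall i, `|x 0 i| <= B) -> (forall i, `|u 0 i - v 0 i| <= d) ->
  enorm (u - x) ^+ 2 <= enorm (v - x) ^+ 2 + n%:R * (4 * B) * d.
Proof.
move=> B0 uB vB xB uvd; rewrite !sqr_enorm.
have -> : n%:R * (4 * B) * d = \sum_(i < n) 4 * B * d.
  by rewrite sumr_const card_ord -mulrA mulr_natl.
rewrite -big_split/=; apply: ler_sum => i _; rewrite !mxE -lerBlDl.
(* In this difference of squares the first factor is at most 4B in absolute value. *)
have -> : (u 0 i - x 0 i) ^+ 2 - (v 0 i - x 0 i) ^+ 2 =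
    (u 0 i + v 0 i - 2 * x 0 i) * (u 0 i - v 0 i) by ring.
apply: le_trans (ler_norm _) _; rewrite normrM.
apply: ler_pM => //.
have := uB i; have := vB i; have := xB i; rewrite !ler_norml.
by move=> /andP[? ?] /andP[? ?] /andP[? ?]; apply/andP; split; lra.
Qed.

Theorem theorem3p1 (R : realType) (n : nat) (U X : set 'rV[R]_n)
    (U_neq0 : U !=set0) (U_compact : compact U)
    (U_convex : @convex_set R 'rV[R]_n U)
    (X_compact : compact X) (X_convex : @convex_set R 'rV[R]_n X)
    (UX : U `<=` X) :
  let Un : set 'M[R]_(n.+1, n) := row_power U in
  [/\ forall M, Un M -> cheb_value X M \is a fin_num,
      [lipschitz (fine (cheb_value X M) : R^o) | M in Un] &
      ereal_inf [set ereal_sup [set (enorm (u - x) ^+ 2)%:E | u in U]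
                | x in X]
      = ereal_sup [set cheb_value X M | M in Un]].
Proof.
move=> Un.
have cheb_fin (M : 'M[R]_(n.+1, n)) : cheb_value X M \is a fin_num.
  by apply: cheb_value_fin_num; have [u /UX Xu] := U_neq0; exists u.
split=> [M _||]; first exact: cheb_fin.
  have [B [_ /(_ (`|B| + 1))]] := compact_bounded X_compact.
  rewrite (le_lt_trans (ler_norm B)) ?ltrDl// => /(_ isT) XB'.
  (* Boundedness holds for every constant strictly above [B], which may be negative; this one is
     also nonnegative. *)
  set C := `|B| + 1 in XB'.
  have C0 : 0 <= C by rewrite addr_ge0.
  have XC x i : X x -> `|x 0 i| <= C.
    by move=> Xx; apply: le_trans (ler_entry_norm _ _ _) (XB' x Xx).
  have chebB M N : Un M -> Un N -> fine (cheb_value X M) <=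
      fine (cheb_value X N) + n%:R * (4 * C) * `|M - N|.
    move=> UM UN; rewrite -lee_fin EFinD !fineK//.
    apply: cheb_value_le => x Xx i.
    apply: sqr_enorm_sub_le => // k; try by apply: XC => //; exact: UX.
    by have := ler_entry_norm (M - N) i k; rewrite !mxE.
  (* The Lipschitz estimate is required for all sufficiently large constants, here all [r] above
     this one. *)
  exists (n%:R * (4 * C)); split; first exact: num_real.
  move=> r /ltW Kr [M N] [/= UM UN].
  apply: le_trans (ler_wpM2r (normr_ge0 _) Kr).
  have := chebB _ _ UM UN; have := chebB _ _ UN UM.
  by rewrite (distrC N) ler_norml => ? ?; apply/andP; split; lra.
apply/eqP; rewrite eq_le; apply/andP; split; last first.
  (* Easy inequality: for each x in [X], the supremum of the squared distances to [U], if finite, is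
     feasible with x for every tuple. *)
  apply: ge_ereal_sup => _ [M UM <-].
  apply: le_ereal_inf_tmp => _ [x Xx <-].
  have : forall u, U u ->
      ((enorm (u - x) ^+ 2)%:E <=
       ereal_sup [set (enorm (u - x) ^+ 2)%:E | u in U])%E.
    by move=> u Uu; apply: ereal_sup_ubound; exists u.
  case: (ereal_sup _) => [t||] Ut; [|exact: leey|].
    apply: ereal_inf_lbound; exists (t, x) => //; split=> //= i.
    by rewrite -lee_fin; exact: Ut (UM i).
  by have [u /Ut] := U_neq0.
have : forall M, Un M ->
    (cheb_value X M <= ereal_sup [set cheb_value X M | M in Un])%E.
  by move=> M UM; apply: ereal_sup_ubound; exists M.
case: (ereal_sup _) => [t||] cheb_t; [|exact: leey|].
(* The slack [e] makes the inequality strict, so that a feasible pair below t + e exists without the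
   infimum being attained. *)
- apply/lee_addgt0Pr => e e0; rewrite -EFinD.
  have [||f|x Xx] := @helly_compact R n {u | u \in U} X
    (fun u => [set x | enorm (val u - x) ^+ 2 <= t + e]) X_compact.
  + by move=> u; exact: closed_eball.
  + move=> u; apply/convex_setP => x y s s01 [Xx xt] [Xy yt].
    split; first exact: (convex_setP X).1.
    by apply: (convex_setP _).1 => //; exact: convex_eball.
  + pose M := \matrix_i val (f i).
    have UM : Un M by move=> i; rewrite rowK; apply/set_mem/(valP (f i)).
    have : (cheb_value X M < (t + e)%:E)%E.
      by rewrite (le_lt_trans (cheb_t M UM))// lte_fin ltrDl.
    move=> /ereal_inf_lt[_ [[r x] [/= Xx Mx] <-]]; rewrite lte_fin => rt.
    exists x => i _; split=> //=.
    by have := Mx i; rewrite rowK => /le_trans; apply; exact: ltW.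
  have [u0 Uu0] := U_neq0.
  have [Xx' _] := Xx (exist _ u0 (mem_set Uu0)) I.
  apply: ge_ereal_inf.
  exists (ereal_sup [set (enorm (u - x) ^+ 2)%:E | u in U]); first by exists x.
  apply: ge_ereal_sup => _ [u Uu <-]; rewrite lee_fin.
  by have [] := Xx (exist _ u (mem_set Uu)) I.
(* A constant tuple has finite value, so the supremum is not -oo. *)
- have [u Uu] := U_neq0.
  have /cheb_t : Un (\matrix_i u) by move=> i; rewrite rowK.
  rewrite leeNy_eq => /eqP chebNy.
  by have := cheb_fin (\matrix_i u); rewrite chebNy.
Qed.
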